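(* Let $X$ be an oriented rank three nondegenerate WSD manifold and let $\mathcal{L}_{\mathbf 3}$ be the real Lie superalgebra generated by the operators $\imath L_j,\imath V_j,\imath\Lambda_j,A_j$ ($j=0,1,2$). Then $\mathcal{L}_{\mathbf 3}$ preserves the form $\langle\ ,\ \rangle_p$ for every $p\in X$. This is equivalent to the fact that the condition $\phi^\star=-*\,\phi\,*$ holds for all the elements $\phi$ of $\mathcal{L}_{\mathbf 3}$.
   Context: WSD manifolds. An oriented rank three nondegenerate WSD manifold is an oriented smooth manifold $X$ of dimension $9$ with a Riemannian metric and closed smooth $2$-forms $\omega_1,\omega_2,\omega_D$ such that the distribution $\omega_1^0+\omega_2^0$ is integrable ($\omega_i^0\subset TX$ is the kernel of $\omega_i$), and such that every $T_p^*X$ has an orthonormal basis $v_{ij}$ ($i=1,2,3$, $j=0,1,2$), called an adapted coframe, with $\omega_1=\sum_i v_{i0}\wedge v_{i1}$, $\omega_2=\sum_i v_{i0}\wedge v_{i2}$, $\omega_D=\sum_i v_{i1}\wedge v_{i2}$ at $p$. The spaces $W_j=\mathrm{span}_{\mathbb R}(v_{1j},v_{2j},v_{3j})$ and the identifications $W_0\cong W_1\cong W_2$, $v_{i0}\leftrightarrow v_{i1}\leftrightarrow v_{i2}$, do not depend on the adapted coframe; $W_0\cong W_1\cong W_2$ are oriented so that $T_p^*X=W_0\oplus W_1\oplus W_2$ has the given orientation, and adapted coframes are always chosen with $(v_{1j},v_{2j},v_{3j})$ oriented. Put $Vol(W_j)=v_{1j}\wedge v_{2j}\wedge v_{3j}$.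 Operators. On complex forms put $L_0=\omega_D\wedge\cdot$, $L_1=-\omega_2\wedge\cdot$, $L_2=\omega_1\wedge\cdot$, $V_j=Vol(W_j)\wedge\cdot$. Let $(\ ,\ )_p$ be the Hermitean inner product on $\bigwedge^*_{\mathbb C}T^*_pX$ induced by the metric (linear in the first variable), $\Omega$ the Riemannian volume form, and $*$ the complex-linear Hodge star, $\alpha\wedge\overline{*\beta}=(\alpha,\beta)_p\Omega$; one has $*^2=Id$. For a homogeneous operator $\phi$ on $\bigwedge^*_{\mathbb C}T^*_pX$, $\phi^\star$ is the homogeneous operator with $(\phi(\alpha),\beta)_p=(-1)^{\deg(\phi)\deg(\alpha)}(\alpha,\phi^\star(\beta))_p$ for homogeneous $\alpha,\beta$ (extended additively to sums of homogeneous operators). Put $\Lambda_j=L_j^\star$, $A_j=V_j^\star$. Operators form a Lie superalgebra under the supercommutator, with $\mathbb Z/2$-grading induced by parity of the degree of forms. $\mathcal{L}_{\mathbf 3}$ is the real Lie subalgebra of the general linear Lie superalgebra of $\Omega^*_{\mathbb C}(X)$ generated by $\imath L_j,\imath V_j,\imath\Lambda_j,A_j$, $j=0,1,2$; its elements act fibrewise on $\bigwedge^*_{\mathbb C}T^*_pX$. Pairing. $\langle\alpha,\beta\rangle_p=(\alpha\wedge\overline\beta,\Omega)_p$. A homogeneous operator $\phi$ preserves it if $\langle\phi(\alpha),\beta\rangle_p+(-1)^{\deg(\alpha)\deg(\phi)}\langle\alpha,\phi(\beta)\rangle_p=0$ for all homogeneous $\alpha,\beta$; a general operator preserves it if its homogeneous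 components do. *)

(* Defs.v *)
From HB Require Import structures.
From mathcomp Require Import all_boot all_order all_algebra.
From mathcomp Require Import all_classical all_reals all_analysis.
From mathcomp Require Import complex.

Set Implicit Arguments.
Unset Strict Implicit.
Unset Printing Implicit Defensive.

Import Order.TTheory GRing.Theory Num.Theory.
Import numFieldNormedType.Exports.

Local Open Scope ring_scope.
Local Open Scope complex_scope.

(** * Exterior algebra of K^n

  An element [a] stands for the sum over S of [a S] dx_S, where dx_S is the
  wedge product of the dx_i, i \in S, in increasing order of i. *)

Definition extalg (K : comNzRingType) (n : nat) := {ffun {set 'I_n} -> K^o}.

Section ExteriorAlgebra.
Variables (K : comNzRingType) (n : nat).
Implicit Types (S T U : {set 'I_n}) (a b : extalg K n).

(* dx_S /\ dx_T = shuffle_sign S T *: dx_(S :|: T) for disjoint S and T *)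
Definition shuffle_sign S T : K :=
  (-1) ^+ #|[set st : 'I_n * 'I_n | [&& st.1 \in S, st.2 \in T
                                      & (st.2 < st.1)%N]]|.

Definition wedge a b : extalg K n :=
  [ffun U : {set 'I_n} => \sum_(S : {set 'I_n} | S \subset U)
               shuffle_sign S (U :\: S) * a S * b (U :\: S)].

Definition homogeneous (k : nat) a := forall S, #|S| != k -> a S = 0.

Definition one_form (v : 'rV[K]_n) : extalg K n :=
  [ffun S : {set 'I_n} => \sum_(i : 'I_n | S == [set i]) v 0 i].

(* interior product with the tangent vector v *)
Definition contract (v : 'rV[K]_n) a : extalg K n :=
  [ffun S : {set 'I_n} => \sum_(i : 'I_n | i \notin S)
               shuffle_sign [set i] S * v 0 i * a (i |: S)].

(* Determinant of the submatrix of A with rows in S and columns in T, both in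
   increasing order; only meaningful, and only used, when #|S| = #|T|. *)
Definition subdet (A : 'M[K]_n) S T : K :=
  \det (\matrix_(i < #|S|, j < #|S|)
          A (enum_val i) (nth (enum_val i) (enum T) j)).

(* Pullback by the linear map v |-> v *m A:  dx_j |-> \sum_i A i j dx_i *)
Definition pullback (A : 'M[K]_n) a : extalg K n :=
  [ffun S : {set 'I_n} => \sum_(T : {set 'I_n} | #|T| == #|S|) subdet A S T * a T].

End ExteriorAlgebra.

Local Open Scope classical_set_scope.

(** * Smooth maps between open subsets of R^n *)

Section Smooth.
Variables (R : realType) (n : nat).
Implicit Types (U : set 'rV[R]_n).

Fixpoint Ck (k : nat) U (f : 'rV[R]_n -> R) : Prop :=
  (forall x, U x -> {for x, continuous f}) /\
  if k is k'.+1 then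
    forall i : 'I_n, (forall x, U x -> derivable f x (delta_mx 0 i)) /\
                     Ck k' U (fun x => 'D_(delta_mx 0 i) f x)
  else True.

Definition smooth U (f : 'rV[R]_n -> R) := forall k, Ck k U f.

Definition smooth_map U (F : 'rV[R]_n -> 'rV[R]_n) :=
  forall i, smooth U (fun x => F x 0 i).

Definition diffeo U (F G : 'rV[R]_n -> 'rV[R]_n) :=
  [/\ open U, open (F @` U), smooth_map U F, smooth_map (F @` U) G
    & forall x, U x -> G (F x) = x].

Definition ext_deriv (a : 'rV[R]_n -> extalg R n) (x : 'rV[R]_n) :
    extalg R n :=
  [ffun S : {set 'I_n} =>
     \sum_(i in S) shuffle_sign R [set i]%SET (S :\ i)%SET *
                   'D_(delta_mx 0 i) (fun y => a y (S :\ i)%SET : R) x].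

End Smooth.

(** * Oriented smooth manifolds

  The orientation is given by the choice of an oriented atlas.  Every point
  comes with a preferred chart [chart_at p], and T_pX and T_p^*X are identified
  with R^n, written as row vectors, through the coordinates of that chart. *)

Record oriented_manifold (R : realType) (n : nat) := OrientedManifold {
  carrier :> topologicalType ;
  chart_index : Type ;
  chart_dom : chart_index -> set carrier ;
  chart : chart_index -> carrier -> 'rV[R]_n ;
  chart_inv : chart_index -> 'rV[R]_n -> carrier ;
  chart_at : carrier -> chart_index ;
  manifold_hausdorff : hausdorff_space carrier ;
  manifold_second_countable : @second_countable carrier ;
  chart_dom_open : forall i, open (chart_dom i) ;
  chart_im_open : forall i, open (chart i @` chart_dom i) ;
  chart_continuous : forall i, {within chart_dom i, continuous (chart i)} ;
  chart_inv_continuous : forall i,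
    {within chart i @` chart_dom i, continuous (chart_inv i)} ;
  chartK : forall i p, chart_dom i p -> chart_inv i (chart i p) = p ;
  chart_at_dom : forall p, chart_dom (chart_at p) p ;
  transition_smooth : forall i j,
    smooth_map (chart i @` (chart_dom i `&` chart_dom j))
               (chart j \o chart_inv i) ;
  transition_oriented : forall i j x,
    (chart i @` (chart_dom i `&` chart_dom j)) x ->
    0 < \det (jacobian (chart j \o chart_inv i) x)
}.

Section Tensors.
Variables (R : realType) (n : nat) (X : oriented_manifold R n).
Implicit Types (i : chart_index X) (x : 'rV[R]_n).

Definition chart_im i : set 'rV[R]_n := chart i @` chart_dom i.

(* For x in the image of chart i, the matrix of the change of coordinates from
   chart i to the preferred chart of the point q with coordinates x: a tangent
   vector at q with components v in chart i has components
   v *m to_preferred i x in the preferred chart. *)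
Definition to_preferred i x : 'M[R]_n :=
  jacobian (chart (chart_at (chart_inv i x)) \o chart_inv i) x.

Definition form_in (w : X -> extalg R n) i x : extalg R n :=
  pullback (to_preferred i x) (w (chart_inv i x)).

Definition smooth_form (w : X -> extalg R n) :=
  forall i S, smooth (chart_im i) (fun x => form_in w i x S : R).

Definition closed_form (w : X -> extalg R n) :=
  forall i x, chart_im i x -> ext_deriv (form_in w i) x = 0.

Definition metric_in (g : X -> 'M[R]_n) i x : 'M[R]_n :=
  to_preferred i x *m g (chart_inv i x) *m (to_preferred i x)^T.

Definition riemannian_metric (g : X -> 'M[R]_n) :=
  [/\ forall p, (g p)^T = g p,
      forall p (v : 'rV[R]_n), v != 0 -> 0 < (v *m g p *m v^T) 0 0
    & forall i a b, smooth (chart_im i) (fun x => metric_in g i x a b)].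

Definition form_kernel (w : X -> extalg R n) (p : X) : set 'rV[R]_n :=
  [set v | contract v (w p) = 0].

Definition distribution_sum (D E : X -> set 'rV[R]_n) (p : X) :
    set 'rV[R]_n :=
  [set v | exists u w, [/\ D p u, E p w & v = u + w]].

(* Near every point there are local coordinates (y_0, ..., y_(n-1)) such that
   the distribution is spanned by the first r coordinate vector fields. *)
Definition integrable_distribution (D : X -> set 'rV[R]_n) :=
  forall p, exists r U y z,
    [/\ U (chart (chart_at p) p), U `<=` chart_im (chart_at p), diffeo U y z
      & forall x v, U x ->
          (D (chart_inv (chart_at p) x) (v *m to_preferred (chart_at p) x) <->
           forall j : 'I_n, (r <= j)%N -> (v *m jacobian y x) 0 j = 0)].

End Tensors.

(** * WSD manifolds *)

Section Coframes.
Variable R : realType.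
Implicit Types (g : 'M[R]_9) (v : {ffun 'I_3 * 'I_3 -> 'rV[R]_9}).

(* Inner product on covectors dual to the inner product g on tangent vectors *)
Definition covector_product g (a b : 'rV[R]_9) : R :=
  (a *m invmx g *m b^T) 0 0.

(* [v (i, j)] is the covector v_ij, with i ranging over 0, 1, 2 instead of
   1, 2, 3 *)
Definition adapted_coframe g (w1 w2 wD : extalg R 9) v :=
  let theta i j := one_form (v (i, j)) in
  [/\ forall s t, covector_product g (v s) (v t) = (s == t)%:R,
      w1 = \sum_(i < 3) wedge (theta i 0) (theta i 1),
      w2 = \sum_(i < 3) wedge (theta i 0) (theta i 2%:R)
    & wD = \sum_(i < 3) wedge (theta i 1) (theta i 2%:R)].

(* The coframe v_10, v_20, v_30, v_11, ..., v_32 is positively oriented, in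
   coordinates of an oriented chart.  As W_0, W_1 and W_2 are oriented
   compatibly with v_i0 <-> v_i1 <-> v_i2 and with W_0 (+) W_1 (+) W_2, this is
   equivalent to each (v_1j, v_2j, v_3j) being oriented. *)
Definition oriented_coframe v :=
  0 < \det (\matrix_(k < 9) v (inord (k %% 3), inord (k %/ 3))).

End Coframes.

Record wsd_manifold (R : realType) := WSDManifold {
  wsd_base :> oriented_manifold R 9 ;
  metric : wsd_base -> 'M[R]_9 ;
  omega1 : wsd_base -> extalg R 9 ;
  omega2 : wsd_base -> extalg R 9 ;
  omegaD : wsd_base -> extalg R 9 ;
  metric_riemannian : riemannian_metric metric ;
  omega1_degree : forall p, homogeneous 2 (omega1 p) ;
  omega2_degree : forall p, homogeneous 2 (omega2 p) ;
  omegaD_degree : forall p, homogeneous 2 (omegaD p) ;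
  omega1_smooth : smooth_form omega1 ;
  omega2_smooth : smooth_form omega2 ;
  omegaD_smooth : smooth_form omegaD ;
  omega1_closed : closed_form omega1 ;
  omega2_closed : closed_form omega2 ;
  omegaD_closed : closed_form omegaD ;
  omega12_integrable : integrable_distribution
    (distribution_sum (form_kernel omega1) (form_kernel omega2)) ;
  adapted_coframe_exists : forall p, exists v,
    adapted_coframe (metric p) (omega1 p) (omega2 p) (omegaD p) v
}.

(** * Operators on the complexified exterior algebra *)

Section Operators.
Variables (R : realType) (n : nat).
Local Notation C := R[i].
Local Notation operator := 'End(extalg C n).
Implicit Types (g : 'M[R]_n) (a b : extalg C n) (phi psi : operator).

Definition complexify (a : extalg R n) : extalg C n := [ffun S : {set 'I_n} => (a S)%:C].

Definition ext_conj a : extalg C n := [ffun S : {set 'I_n} => (a S : C)^*].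

Definition degree_proj (k : nat) : operator :=
  linfun (fun a : extalg C n =>
            [ffun S : {set 'I_n} => if #|S| == k then a S else 0] : extalg C n).

Definition wedge_op (a : extalg R n) : operator :=
  linfun (wedge (complexify a)).

(* Homogeneous component of degree d; it vanishes unless - n <= d <= n *)
Definition component (d : int) phi : operator :=
  \sum_(k < n.+1) \sum_(l < n.+1 | l%:Z == k%:Z + d)
     (degree_proj l \o (phi \o degree_proj k))%VF.

(* Even (e = false) and odd (e = true) parts *)
Definition parity_part (e : bool) phi : operator :=
  \sum_(k < n.+1) \sum_(l < n.+1 | odd (k + l) == e)
     (degree_proj l \o (phi \o degree_proj k))%VF.

Definition supercommutator phi psi : operator :=
  \sum_(e : bool) \sum_(f : bool)
    ((parity_part e phi \o parity_part f psi)%VF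
     - (-1) ^+ (e && f) *: (parity_part f psi \o parity_part e phi)%VF).

(* Hermitian inner product on forms, linear in the first variable, induced by
   the inner product g on tangent vectors: (dx_S, dx_T) is the Gram determinant
   of the dual inner product if #|S| = #|T|, and 0 otherwise. *)
Definition herm g a b : C :=
  \sum_(S : {set 'I_n}) \sum_(T : {set 'I_n} | #|S| == #|T|)
    (a S : C) * (b T : C)^*%C * (subdet (invmx g) S T)%:C.

(* Riemannian volume form, in coordinates of an oriented chart *)
Definition volume_form g : extalg R n :=
  [ffun S : {set 'I_n} => if S == [set: 'I_n]%SET then Num.sqrt (\det g) else 0].

Definition is_hodge_star g phi :=
  forall k, (k <= n)%N ->
    (forall b, homogeneous k b -> homogeneous (n - k) (phi b)) /\
    (forall a b, homogeneous k a -> homogeneous k b ->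
       wedge a (ext_conj (phi b)) = herm g a b *: complexify (volume_form g)).

Definition hodge g : operator := xget 0 [set phi | is_hodge_star g phi].

Definition is_adjoint g (d : int) phi psi :=
  forall k l a b, homogeneous k a -> homogeneous l b ->
    herm g (phi a) b = (-1) ^+ (`|d|%N * k) * herm g a (psi b).

(* The operator phi^star for phi homogeneous of degree d, and then for all phi *)
Definition adjoint_homogeneous g (d : int) phi : operator :=
  xget 0 [set psi | is_adjoint g d phi psi].

Definition adjoint g phi : operator :=
  \sum_(m < n.*2.+1)
     let d := m%:Z - n%:Z in adjoint_homogeneous g d (component d phi).

Definition pairing g a b : C :=
  herm g (wedge a (ext_conj b)) (complexify (volume_form g)).

Definition preserves_homogeneous g (d : int) phi :=
  forall k l a b, homogeneous k a -> homogeneous l b ->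
    pairing g (phi a) b + (-1) ^+ (k * `|d|%N) * pairing g a (phi b) = 0.

Definition preserves_pairing g phi :=
  forall d : int, preserves_homogeneous g d (component d phi).

(* A fibrewise operator on forms on X is a function from X to operators;
   addition, scaling and brackets are pointwise. *)
Definition real_lie_subalgebra (X : Type) (A : set (X -> operator)) :=
  [/\ A (fun=> 0),
      forall Phi Psi, A Phi -> A Psi -> A (fun p => Phi p + Psi p),
      forall (r : R) Phi, A Phi -> A (fun p => r%:C *: Phi p)
    & forall Phi Psi, A Phi -> A Psi ->
        A (fun p => supercommutator (Phi p) (Psi p))].

End Operators.

Section WSDOperators.
Variables (R : realType) (X : wsd_manifold R).
Local Notation operator := 'End(extalg R[i] 9).
Implicit Types (p : X) (j : 'I_3).

Definition oriented_adapted_coframe p : {ffun 'I_3 * 'I_3 -> 'rV[R]_9} :=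
  xget 0 [set v | adapted_coframe (metric p) (omega1 p) (omega2 p) (omegaD p) v
                  /\ oriented_coframe v].

(* Does not depend on the choice of the oriented adapted coframe *)
Definition Vol j p : extalg R 9 :=
  let theta i := one_form (oriented_adapted_coframe p (i, j)) in
  wedge (theta 0) (wedge (theta 1) (theta 2%:R)).

Definition opL j p : operator :=
  tnth [tuple wedge_op (omegaD p); - wedge_op (omega2 p); wedge_op (omega1 p)]
       j.

Definition opV j p : operator := wedge_op (Vol j p).

Definition opLambda j p : operator := adjoint (metric p) (opL j p).

Definition opA j p : operator := adjoint (metric p) (opV j p).

Definition L3_generators : set (X -> operator) :=
  range (fun j p => 'i%C *: opL j p) `|` range (fun j p => 'i%C *: opV j p)
  `|` range (fun j p => 'i%C *: opLambda j p) `|` range opA.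

Definition L3 : set (X -> operator) :=
  smallest (@real_lie_subalgebra R 9 X) L3_generators.

End WSDOperators.

(* Main.v *)
Require Import Defs.
From HB Require Import structures.
From mathcomp Require Import all_boot all_order all_algebra.
From mathcomp Require Import all_classical all_reals all_analysis.
From mathcomp Require Import complex ring zify.
From mathcomp Require Import fintype finset.

Set Implicit Arguments.
Unset Strict Implicit.
Unset Printing Implicit Defensive.

Import Order.TTheory GRing.Theory Num.Theory.

(** Fix a point p and write (a, b) for the Hermitian product and <a, b> for the
  pairing.  Since a /\ conj (star b) = (a, b) vol and star is an involution in
  dimension 9, <a, b> = (a, star b) ([pairing_star]).  Substituting star b for b
  in the identity that says that phi preserves the pairing turns it into the
  identity that characterizes - star phi star as the adjoint of phi
  ([preserves_adjoint]).  The signs fit because only forms whose degrees add up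
  to 9 - deg phi are paired nontrivially.  Indeed, on forms a and b of degrees
  k and l, only the component of phi of degree 9 - k - l contributes, and
  (-1)^(k (9 - k - l)) = (-1)^(k l).  So phi preserves the pairing exactly when
  <phi a, b> + (-1)^(k l) <a, phi b> = 0 for all a and b, a condition that does
  not mention the components of phi and depends on k and l only through their
  parities ([preserves_pairingP]); the adjoint has a similar description
  ([adjointP]).

  It remains to see that L_3 consists of such operators.
  - Wedging with i times a real form of degree m preserves the pairing: moving
    the form across a costs (-1)^(m k), and the factor i changes sign under
    conjugation ([wedge_op_preserves]).  This covers the i L_j and the i V_j.
  - If phi preserves the pairing, so does its adjoint when phi is even, and i
    times its adjoint when phi is odd ([adjoint_preserves]).  As the adjoint is
    antilinear in phi, this covers the i Lambda_j, for phi = i L_j, and the A_j,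
    without a factor i, for phi = i V_j.
  - Preservation is stable under real combinations and under supercommutators
    ([supercommutator_preserves]).

  The remaining work is the existence of the star and star star = 1.  In
  arbitrary coordinates the star is a formula in the minors of the inverse of
  the metric matrix, and star star = 1 is Jacobi's relation between
  complementary minors.  That relation follows from Laplace's expansion along
  several rows ([laplace]), which holds because the coefficients of a wedge
  product of one-forms are minors ([wedge_seqE]). *)

Local Open Scope ring_scope.

(** * Shuffle signs *)

Lemma big_disjoint_setU (I : finType) (S T : {set I}) (F : I -> nat) :
  [disjoint S & T] ->
  (\sum_(i in S :|: T) F i = \sum_(i in S) F i + \sum_(i in T) F i)%N.
Proof.
by move=> dST; under eq_bigl => i do rewrite finset.in_setU; rewrite bigU.
Qed.

Lemma card_ltnS (n : nat) (S : {set 'I_n}) : (#|S| < n.+1)%N.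
Proof. by rewrite ltnS -[X in (_ <= X)%N]card_ord max_card. Qed.

Section ShuffleSign.
Variables (K : comNzRingType) (n : nat).
Implicit Types S T U : {set 'I_n}.
Local Notation sgn := (@shuffle_sign K n).

(** In this form, additivity of the inversion count in either set is additivity
  of sums over disjoint unions. *)
Lemma shuffle_sign_sum S T :
  sgn S T = (-1) ^+ (\sum_(s in S) \sum_(t in T) (t < s)%N)%N.
Proof.
rewrite /shuffle_sign; congr (_ ^+ _).
rewrite pair_big_dep /= big_mkcond /= -sum1_card big_mkcond /=.
apply: eq_bigr => -[s t] _ /=; rewrite inE /=.
by case: (s \in S); case: (t \in T) => //=; case: (t < s)%N.
Qed.

Lemma shuffle_signUl S T U : [disjoint S & T] ->
  sgn (S :|: T) U = sgn S U * sgn T U.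
Proof.
by move=> dST; rewrite !shuffle_sign_sum -exprD big_disjoint_setU.
Qed.

Lemma shuffle_signUr S T U : [disjoint T & U] ->
  sgn S (T :|: U) = sgn S T * sgn S U.
Proof.
move=> dTU; rewrite !shuffle_sign_sum -exprD -big_split /=.
by congr (_ ^+ _); apply: eq_bigr => s _; rewrite big_disjoint_setU.
Qed.

Lemma shuffle_sign_sqr S T : sgn S T * sgn S T = 1.
Proof. by rewrite -expr2 sqrr_sign. Qed.

(** Each of the pairs in S x T is an inversion in exactly one of the two
  orders. *)
Lemma shuffle_signC S T : [disjoint S & T] ->
  sgn S T = (-1) ^+ (#|S| * #|T|) * sgn T S.
Proof.
move=> dST.
suff -> : (#|S| * #|T|)%N = (\sum_(s in S) \sum_(t in T) (t < s)%N
                    + \sum_(t in T) \sum_(s in S) (s < t)%N)%N.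
  by rewrite !shuffle_sign_sum exprD -mulrA -expr2 sqrr_sign mulr1.
rewrite [X in (_ + X)%N]exchange_big -big_split /= -sum_nat_const.
apply: eq_bigr => s sS; rewrite -big_split /= -sum1_card.
apply: eq_bigr => t tT; case: ltngtP => // /val_inj est.
by move: dST => /disjointFr/(_ sS); rewrite -est tT.
Qed.

Lemma shuffle_sign0l T : sgn set0 T = 1.
Proof. by rewrite shuffle_sign_sum big_set0. Qed.

End ShuffleSign.

(** * The wedge product *)

Section Wedge.
Variables (K : comNzRingType) (n : nat).
Implicit Types (S T U : {set 'I_n}) (a b c : extalg K n) (v : 'rV[K]_n).
Local Notation sgn := (@shuffle_sign K n).

(** Both sides are sums over the ordered partitions of U into three blocks, and
  the two signs count the same inversions between the blocks. *)
Lemma wedgeA a b c : wedge a (wedge b c) = wedge (wedge a b) c.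
Proof.
apply/ffunP => U; rewrite !ffunE.
under eq_bigr => S SU do rewrite ffunE mulr_sumr.
under [RHS]eq_bigr => V VU do rewrite ffunE mulr_sumr mulr_suml.
rewrite [RHS](exchange_big_dep (fun S => S \subset U)) /=; last first.
  move=> V S VU SV. by apply: (subset_trans SV VU).
apply: eq_bigr => S SU.
rewrite [RHS](reindex_onto (fun T => S :|: T) (fun V => V :\: S)) /=; last first.
  by move=> V /andP[VU SV]; rewrite setDE setUIr setUCr setIT; apply/setUidPr.
apply: eq_big => [T|T TUS].
  rewrite subUset SU subsetUl andbT /= setDUl setDv set0U.
  rewrite subsetD; congr (_ && _).
  by apply/idP/eqP => /setDidPl.
have /andP[TU dTS] : (T \subset U) && [disjoint T & S] by rewrite -subsetD.
have -> : (S :|: T) :\: S = T by rewrite setDUl setDv set0U; apply/setDidPl.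
have -> : U :\: S :\: T = U :\: (S :|: T) by rewrite setDDl.
have dST : [disjoint S & T] by rewrite disjoint_sym.
rewrite shuffle_signUl //.
have -> : U :\: S = T :|: (U :\: (S :|: T)).
  apply/setP => i; rewrite !inE; have := disjointFr dTS (x := i).
  have := subsetP TU i.
  by case: (i \in T) => /= [->// ->|_ _]; rewrite ?orbF.
rewrite shuffle_signUr; first by ring.
rewrite -setI_eq0; apply/eqP/setP => i; rewrite !inE.
by case: (i \in T); rewrite ?orbT.
Qed.

Lemma wedgeC k l a b : homogeneous k a -> homogeneous l b ->
  wedge a b = (-1) ^+ (k * l) *: wedge b a.
Proof.
move=> ha hb; apply/ffunP => U; rewrite !ffunE scaler_sumr.
rewrite (reindex_onto (fun S => U :\: S) (fun S => U :\: S)) /=; last first.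
  by move=> S SU; rewrite setDDr setDv set0U; apply/setIidPr.
apply: eq_big => [S|S /andP[_ /eqP <-]].
  by rewrite subsetDl setDDr setDv set0U /=; apply/eqP/idP => /setIidPr.
set S' := U :\: S.
have -> : U :\: (U :\: S') = S' by apply/setP => i; rewrite !inE; case: (i \in U); case: (i \in S).
have dS : [disjoint S' & U :\: S'].
  rewrite -setI_eq0; apply/eqP/setP => i; rewrite !inE.
  by case: (i \in S); case: (i \in U).
have [kS|/ha ->] := eqVneq #|S'| k; last by rewrite !(mulr0, mul0r, scaler0).
have [lS|/hb ->] := eqVneq #|U :\: S'| l; last by rewrite !(mulr0, mul0r, scaler0).
rewrite shuffle_signC // kS lS [RHS]/GRing.scale /=.
by rewrite -!mulrA [b _ * _]mulrC.
Qed.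

Lemma wedge_homogeneous k l a b : homogeneous k a -> homogeneous l b ->
  homogeneous (k + l) (wedge a b).
Proof.
move=> ha hb U; rewrite ffunE => kl; apply: big1 => S SU.
have [kS|/ha ->] := eqVneq #|S| k; last by rewrite mulr0 mul0r.
rewrite (hb (U :\: S)) ?mulr0 //; apply: contra_neq kl => <-.
by rewrite -kS cardsDS // subnKC // subset_leq_card.
Qed.

Lemma wedge_top a b :
  wedge a b setT = \sum_S sgn S (~: S) * a S * b (~: S).
Proof.
by rewrite ffunE; apply: eq_big => [S|S _]; rewrite ?subsetT // setTD.
Qed.

Lemma one_form_homogeneous v : homogeneous 1 (one_form v).
Proof.
move=> S S1; rewrite ffunE big1 // => i /eqP Si.
by rewrite Si cards1 in S1.
Qed.

Lemma wedge_one_form v a U :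
  wedge (one_form v) a U = \sum_(i in U) sgn [set i] (U :\ i) * v 0 i * a (U :\ i).
Proof.
rewrite ffunE.
under eq_bigr => S SU do rewrite ffunE mulr_sumr mulr_suml.
rewrite (exchange_big_dep (fun i => i \in U)) /=; last first.
  by move=> S i SU /eqP Si; rewrite -sub1set -Si.
apply: eq_bigr => i iU; rewrite (big_pred1 [set i]) // => S /=.
by apply: andb_idl => /eqP ->; rewrite sub1set.
Qed.

(** The fold ends in the unit of the exterior algebra. *)
Definition wedge_seq (vs : seq 'rV[K]_n) : extalg K n :=
  foldr (fun v a => wedge (one_form v) a) [ffun S : {set 'I_n} => (S == set0)%:R : K] vs.

Lemma wedge_seq_cat vs ws :
  wedge_seq (vs ++ ws) = wedge (wedge_seq vs) (wedge_seq ws).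
Proof.
elim: vs => [|v vs IH] /=; last by rewrite IH wedgeA.
apply/ffunP => U; rewrite [RHS]ffunE (bigD1 set0) ?sub0set //= big1 ?addr0.
  by rewrite shuffle_sign0l ffunE eqxx mulr1 mul1r setD0.
by move=> S /andP[_ /negPf S0]; rewrite ffunE S0 mulr0 mul0r.
Qed.

Lemma wedge_seq_homogeneous vs : homogeneous (size vs) (wedge_seq vs).
Proof.
elim: vs => [|v vs IH] /=.
  by move=> S; rewrite ffunE cards_eq0 => /negPf ->.
exact: (wedge_homogeneous (@one_form_homogeneous v) IH).
Qed.

Lemma enumD1 (T : {set 'I_n}) (t : 'I_n) : enum (T :\ t) = seq.filter (predC1 t) (enum T).
Proof.
rewrite /enum_mem -filter_predI; apply: eq_filter => i /=.
by rewrite !inE.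
Qed.

(** Subsets of 'I_n are enumerated in increasing order, so positions in the
  enumeration count smaller elements, as shuffle signs do. *)
Lemma ltn_nth_enum (t0 : 'I_n) (T : {set 'I_n}) i j :
  (i < #|T|)%N -> (j < #|T|)%N ->
  (nth t0 (enum T) i < nth t0 (enum T) j)%N = (i < j)%N.
Proof.
have ltT : sorted (relpre val ltn) (enum T).
  have -> : enum T = seq.filter (mem T) (enum 'I_n) by rewrite enumT.
  apply: sorted_filter => [x y z|]; first exact: ltn_trans.
  by rewrite -sorted_map val_enum_ord iota_ltn_sorted.
have tr : transitive (relpre (@nat_of_ord n) ltn) by move=> x y z; apply: ltn_trans.
rewrite cardE => iT jT; have mono := sorted_ltn_nth tr t0 ltT.
case: (ltngtP i j) => [ij|ji|->]; last by rewrite ltnn.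
  exact: (mono i j iT jT ij).
by apply/negbTE; rewrite -leqNgt ltnW //; apply: (mono j i jT iT ji).
Qed.

(** The coefficients of a product of one-forms are minors: wedging with one
  more one-form on the left is the Laplace expansion along the first row, the
  sign of t in T being (-1) to the position of t in T. *)
Lemma wedge_seqE (t0 : 'I_n) k vs (T : {set 'I_n}) : size vs = k -> #|T| = k ->
  wedge_seq vs T =
    \det (\matrix_(i < k, j < k) (nth 0 vs i) 0 (nth t0 (enum T) j)).
Proof.
elim: k vs T => [|k IH] [|v vs] T //=.
  by move=> _ /cards0_eq ->; rewrite ffunE eqxx det_mx00.
move=> /succn_inj sv cT; rewrite wedge_one_form (expand_det_row _ ord0).
have sT : size (enum T) = k.+1 by rewrite -cardE.
have us : uniq (enum T) := enum_uniq _.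
rewrite -big_enum (big_nth t0) sT big_mkord; apply: eq_bigr => j _.
rewrite mxE /= /cofactor add0n [RHS]mulrA [X in _ = X * _]mulrC.
set t := nth t0 (enum T) j.
have tT : t \in T by rewrite -mem_enum mem_nth ?sT.
congr (_ * _ * _).
  rewrite shuffle_sign_sum big_set1; congr (_ ^+ _).
  transitivity (\sum_(t' in T) (t' < t)%N)%N.
    rewrite [RHS](bigD1 t) //= ltnn add0n; apply: eq_bigl => i.
    by rewrite !inE andbC.
  rewrite -big_enum (big_nth t0) sT /=.
  under eq_big_nat => i /andP[_ ik] do rewrite ltn_nth_enum ?cT //.
  rewrite (big_cat_nat (leq0n j) (ltnW (ltn_ord j))) /=.
  rewrite (eq_big_nat _ _ (F2 := fun=> 1%N)); last by move=> i /andP[_ ->].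
  rewrite sum_nat_const_nat subn0 muln1 big_nat big1 ?addn0 // => i.
  by case/andP=> /leq_gtF ->.
rewrite IH //; last by apply/succn_inj; rewrite -cT (cardsD1 t T) tT.
congr (\det _); apply/matrixP => x y; rewrite !mxE /=.
congr (fun_of_matrix _ 0 _).
rewrite enumD1 -rem_filter // remE index_uniq ?sT //.
rewrite nth_cat size_take sT ltn_ord /bump; case: ltnP => yj.
  by rewrite add0n nth_take.
by rewrite nth_drop addSn subnKC.
Qed.

End Wedge.

(** * Minors and the Laplace expansion *)

Section Laplace.
Variables (K : comNzRingType) (n : nat).
Implicit Types (S T U : {set 'I_n}) (A : 'M[K]_n).
Local Notation sgn := (@shuffle_sign K n).

(** The products [wedge_seq (rows A (enum S))] are the images of the basis forms
  dx_S under the algebra morphism dx_i |-> row i A. *)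
Definition rows A (s : seq 'I_n) := [seq row i A | i <- s].

Lemma subdet_nth (t0 : 'I_n) k A S T : #|S| = k -> #|T| = k ->
  subdet A S T =
    \det (\matrix_(i < k, j < k) A (nth t0 (enum S) i) (nth t0 (enum T) j)).
Proof.
move=> <- ST; congr (\det _); apply/matrixP => i j; rewrite !mxE.
rewrite (enum_val_nth t0); congr (A _ _).
by apply: set_nth_default; rewrite -cardE ST.
Qed.

Lemma subdetE A S T : #|S| = #|T| -> subdet A S T = wedge_seq (rows A (enum S)) T.
Proof.
move=> ST; case: (posnP #|T|) => [T0|]; last first.
  case/card_gt0P => t0 _; rewrite (subdet_nth t0 A ST erefl).
  rewrite (wedge_seqE t0 (k := #|T|)) //; last by rewrite size_map -cardE.
  congr (\det _); apply/matrixP => i j; rewrite !mxE (nth_map t0) ?mxE //.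
  by rewrite -cardE ST.
have := ST; rewrite T0 => /cards0_eq S0; rewrite /subdet S0 enum_set0 /= ffunE.
rewrite (cards0_eq T0) eqxx; move: (enum_val (A := _)); rewrite cards0 => f.
by rewrite det_mx00.
Qed.

Lemma subdet_tr A S T : #|S| = #|T| -> subdet A^T S T = subdet A T S.
Proof.
move=> ST; case: (posnP #|T|) => [T0|]; last first.
  case/card_gt0P => t0 _; rewrite !(subdet_nth t0 (k := #|T|)) // -det_tr.
  by congr (\det _); apply/matrixP => i j; rewrite !mxE.
have := ST; rewrite T0 => /cards0_eq S0.
by rewrite !subdetE // S0 (cards0_eq T0) enum_set0.
Qed.

(** The rows of A listed by s are the rows of Q A, where Q lists the rows of the
  identity; the top coefficients are \det (Q A) and \det Q.  This computes the
  sign of the row permutation, or the vanishing for repeated rows, from the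
  case A = 1. *)
Lemma wedge_rows_top A s : size s = n ->
  wedge_seq (rows A s) setT = wedge_seq (rows 1%:M s) setT * \det A.
Proof.
have det0 m (B : 'M[K]_m) : m = 0%N -> \det B = 1.
  by move=> m0; subst m; rewrite det_mx00.
case: (posnP n) => [n0|n_gt0] sn.
  have -> : s = [::] by apply: size0nil; rewrite sn.
  by rewrite det0 // mulr1.
pose i0 := Ordinal n_gt0.
have cT : #|[set: 'I_n]| = n by rewrite cardsT card_ord.
rewrite !(wedge_seqE i0 (k := n)) ?size_map // -det_mulmx; congr (\det _).
apply/matrixP => i j; rewrite !mxE enum_setT -enumT nth_ord_enum (nth_map i0) ?sn //.
rewrite mxE (bigD1 (nth i0 s i)) //= big1 => [|k ki].
  by rewrite !mxE addr0 (nth_map i0) ?sn // nth_ord_enum !mxE eqxx mul1r.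
by rewrite mxE (nth_map i0) ?sn // nth_ord_enum !mxE eq_sym (negPf ki) mul0r.
Qed.

Lemma wedge_rows1 S T : wedge_seq (rows 1%:M (enum S)) T = (S == T)%:R.
Proof.
have [ST|ST] := eqVneq #|S| #|T|; last first.
  rewrite wedge_seq_homogeneous; last by rewrite size_map -cardE eq_sym.
  by case: (S =P T) ST => [->|//]; rewrite eqxx.
rewrite -subdetE //; have [<-|neST] := eqVneq S T.
  rewrite -[RHS](det1 K #|S|); congr (\det _); apply/matrixP => i j.
  rewrite !mxE -[nth _ _ _](enum_val_nth (enum_val i)).
  by rewrite (inj_eq enum_val_inj).
have /subsetPn[i iS iT] : ~~ (S \subset T).
  by apply: contra_neqN neST => ST'; apply/eqP; rewrite eqEcard ST' ST /=.
rewrite /subdet (expand_det_row _ (enum_rank_in iS i)) big1 // => j _.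
rewrite !mxE enum_rankK_in //; case: eqP => [e|]; last by rewrite mul0r.
by case/negP: iT; rewrite e -mem_enum mem_nth // -cardE -ST.
Qed.

Lemma subdet_top A : subdet A setT setT = \det A.
Proof.
by rewrite subdetE // wedge_rows_top ?wedge_rows1 ?eqxx ?mul1r // -cardE cardsT
  card_ord.
Qed.

(** The left-hand side is the top coefficient of the product of the images of
  dx_S and dx_U, hence \det A times that of dx_S /\ dx_U. *)
Lemma laplace A S U : (#|S| + #|U| = n)%N ->
  \sum_(T : {set 'I_n} | #|T| == #|S|)
     sgn T (~: T) * subdet A S T * subdet A U (~: T) =
  (U == ~: S)%:R * sgn S U * \det A.
Proof.
move=> SU.
have sz (V : {set 'I_n}) : size (rows A (enum V)) = #|V| by rewrite size_map -cardE.
transitivity (wedge_seq (rows A (enum S ++ enum U)) setT).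
  rewrite /rows map_cat wedge_seq_cat wedge_top big_mkcond /=.
  apply: eq_bigr => T _; case: ifPn => [/eqP TS|TS]; last first.
    by rewrite (@wedge_seq_homogeneous _ _ (rows A (enum S))) ?sz // mulr0 mul0r.
  have cU : #|U| = #|~: T|.
    by apply: (@addnI #|S|); rewrite SU -TS cardsC card_ord.
  by rewrite !subdetE.
rewrite wedge_rows_top; last by rewrite size_cat -!cardE.
congr (_ * _); rewrite /rows map_cat wedge_seq_cat wedge_top (bigD1 S) //=.
rewrite [X in _ + X]big1 ?addr0 => [|T /negPf TS]; last first.
  by rewrite !wedge_rows1 eq_sym TS mulr0 mul0r.
rewrite !wedge_rows1 eqxx mulr1 mulrC; case: eqP => [->|]; first by [].
by rewrite !mul0r.
Qed.

End Laplace.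

Local Open Scope complex_scope.

(** * Complex forms and homogeneous components of operators *)

Lemma linfunE (K : fieldType) (aT rT : vectType K) (f : aT -> rT) :
  linear f -> linfun f =1 f.
Proof.
move=> lf; pose mx := GRing.isLinear.Build K aT rT _ f lf.
by pose F : {linear aT -> rT} := HB.pack f mx; apply: (lfunE F).
Qed.

Section ComplexForms.
Variables (R : realType) (n : nat).
Local Notation C := R[i].
Local Notation form := (extalg C n).
Implicit Types (S T U : {set 'I_n}) (a b c : form) (phi psi : 'End(form)).

Definition dx S : form := [ffun T => (T == S)%:R].

Lemma dx_homogeneous S : homogeneous #|S| (dx S).
Proof. by move=> T; rewrite ffunE; case: (T =P S) => [->|//]; rewrite eqxx. Qed.

Lemma form_sum_dx a : a = \sum_S a S *: dx S.
Proof.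
apply/ffunP => T; rewrite sum_ffunE (bigD1 T) //= big1 => [|S /negPf ST].
  by rewrite !ffunE eqxx addr0 [RHS]mulr1.
by rewrite !ffunE eq_sym ST scaler0.
Qed.

Lemma wedgeDr a b c : wedge a (b + c) = wedge a b + wedge a c.
Proof.
apply/ffunP => U; rewrite !ffunE -big_split /=.
by apply: eq_bigr => S _; rewrite !ffunE mulrDr.
Qed.

Lemma wedgeZr x a b : wedge a (x *: b) = x *: wedge a b.
Proof.
apply/ffunP => U; rewrite !ffunE scaler_sumr.
by apply: eq_bigr => S _; rewrite !ffunE /GRing.scale /= mulrCA.
Qed.

Lemma wedge_linear a : linear (wedge a).
Proof. by move=> x b c; rewrite wedgeDr wedgeZr. Qed.

Lemma wedgeZl x a b : wedge (x *: a) b = x *: wedge a b.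
Proof.
apply/ffunP => U; rewrite !ffunE scaler_sumr.
by apply: eq_bigr => S _; rewrite !ffunE /GRing.scale /= mulrCA !mulrA.
Qed.

Lemma wedge_dx_top S b : wedge (dx S) b setT = shuffle_sign C S (~: S) * b (~: S).
Proof.
rewrite wedge_top (bigD1 S) //= big1 => [|T /negPf TS].
  by rewrite ffunE eqxx mulr1 addr0.
by rewrite ffunE TS mulr0 mul0r.
Qed.

Lemma shuffle_signE S T : shuffle_sign C S T = (shuffle_sign R S T)%:C.
Proof. by rewrite /shuffle_sign rmorphXn /= rmorphN1. Qed.

Lemma ext_conjE a S : ext_conj a S = (a S)^*%C.
Proof. by rewrite ffunE. Qed.

Lemma conj_shuffle_sign S T : (shuffle_sign C S T)^*%C = shuffle_sign C S T.
Proof. by rewrite shuffle_signE conjc_real. Qed.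

Lemma ext_conjD a b : ext_conj (a + b) = ext_conj a + ext_conj b.
Proof. by apply/ffunP => S; rewrite !ffunE rmorphD. Qed.

Lemma ext_conjZ x a : ext_conj (x *: a) = x^*%C *: ext_conj a.
Proof. by apply/ffunP => S; rewrite !ffunE rmorphM. Qed.

Lemma ext_conj_complexify (a : extalg R n) : ext_conj (complexify a) = complexify a.
Proof. by apply/ffunP => S; rewrite !ffunE conjc_real. Qed.

Lemma ext_conj_wedge a b : ext_conj (wedge a b) = wedge (ext_conj a) (ext_conj b).
Proof.
apply/ffunP => U; rewrite !ffunE rmorph_sum; apply: eq_bigr => S _.
by rewrite !rmorphM /= conj_shuffle_sign !ffunE.
Qed.

Lemma ext_conj_homogeneous k a : homogeneous k a -> homogeneous k (ext_conj a).
Proof. by move=> ha S kS; rewrite ffunE ha // conjc0. Qed.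

Lemma complexify_homogeneous k (a : extalg R n) :
  homogeneous k a -> homogeneous k (complexify a).
Proof. by move=> ha S kS; rewrite ffunE ha. Qed.

Lemma degree_projE k a S : degree_proj R n k a S = if #|S| == k then a S else 0.
Proof.
rewrite /degree_proj linfunE ?ffunE // => x b c; apply/ffunP => T.
by rewrite !ffunE; case: ifP; rewrite ?scaler0 ?addr0.
Qed.

Lemma wedge_opE (a : extalg R n) b : wedge_op a b = wedge (complexify a) b.
Proof. by rewrite /wedge_op linfunE //; apply: wedge_linear. Qed.

Lemma degree_proj_homogeneous k a : homogeneous k (degree_proj R n k a).
Proof. by move=> S /negPf kS; rewrite degree_projE kS. Qed.

Lemma degree_proj_id k l a : homogeneous k a ->
  degree_proj R n l a = if l == k then a else 0.
Proof.
move=> ha; apply/ffunP => S; rewrite degree_projE.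
have [kS|kS] := eqVneq #|S| k; first by rewrite eq_sym kS; case: ifP; rewrite ?ffunE.
by rewrite (ha S kS); case: ifP; case: ifP; rewrite ?ffunE ?(ha S kS).
Qed.

(** The sum of the homogeneous components of [a] lives in degrees of parity s.
  Only parities matter in the signs below. *)
Definition form_parity (s : bool) a := forall S, odd #|S| != s -> a S = 0.

Lemma homogeneous_parity k a : homogeneous k a -> form_parity (odd k) a.
Proof. by move=> ha S kS; apply: ha; apply: contra_neq kS => ->. Qed.

Lemma form_parity_sum s a : form_parity s a ->
  a = \sum_(k < n.+1 | odd k == s) degree_proj R n k a.
Proof.
move=> ha; apply/ffunP => S; rewrite sum_ffunE.
have Sn := card_ltnS S.
have [os|os] := eqVneq (odd #|S|) s.
  rewrite (bigD1 (Ordinal Sn)) /= ?os // big1 => [|k /andP[_ kS]].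
    by rewrite degree_projE eqxx addr0.
  rewrite degree_projE; case: eqP => // e; case/eqP: kS.
  exact: val_inj.
rewrite ha // big1 // => k /eqP ks; rewrite degree_projE; case: eqP => // e.
by rewrite e ks eqxx in os.
Qed.

(** Components and parity parts of operators are both sums of blocks, going from
  degree k to degree l, over a relation P between k and l. *)
Lemma block_sumE (P : nat -> nat -> bool) phi a S :
  (\sum_(k < n.+1) \sum_(l < n.+1 | P k l)
     (degree_proj R n l \o (phi \o degree_proj R n k))%VF) a S =
  \sum_(k < n.+1 | P k #|S|) phi (degree_proj R n k a) S.
Proof.
have Sn := card_ltnS S.
rewrite sum_lfunE sum_ffunE [RHS]big_mkcond /=; apply: eq_bigr => k _.
rewrite sum_lfunE sum_ffunE big_mkcond /= (bigD1 (Ordinal Sn)) //= big1.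
  by rewrite !lfunE /= lfunE /= degree_projE eqxx addr0.
move=> l lS; case: ifP => // _; rewrite !lfunE /= degree_projE.
by case: eqP => // e; case/eqP: lS; apply: val_inj.
Qed.

Lemma componentE d phi k a S : homogeneous k a ->
  component d phi a S = if #|S|%:Z == k%:Z + d then phi a S else 0.
Proof.
move=> ha; rewrite /component (block_sumE (fun k l => l%:Z == k%:Z + d)).
under eq_bigr => l _ do rewrite (degree_proj_id l ha).
have [kn|nk] := ltnP k n.+1; last first.
  have -> : a = 0.
    by apply/ffunP => T; rewrite ha ?ffunE // neq_ltn (leq_trans (card_ltnS T) nk).
  by rewrite big1 => [|l _]; rewrite ?if_same ?linear0 !ffunE ?if_same.
rewrite big_mkcond (bigD1 (Ordinal kn)) //= eqxx big1 ?addr0 // => l lk.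
case: ifP => // _; case: eqP => [e|]; first by case/eqP: lk; apply: val_inj.
by rewrite linear0 ffunE.
Qed.

Lemma parity_partE e phi s a S : form_parity s a ->
  parity_part e phi a S = if odd #|S| == s (+) e then phi a S else 0.
Proof.
move=> ha; rewrite /parity_part (block_sumE (fun k l => odd (k + l) == e)).
case: ifPn => [/eqP oS|oS].
  rewrite {2}(form_parity_sum ha) linear_sum sum_ffunE.
  by apply: eq_bigl => k; rewrite oddD oS; case: (odd k) (s) (e) => [] [] [].
apply: big1 => k /eqP oe; rewrite (_ : degree_proj R n k a = 0) ?linear0 ?ffunE //.
apply/ffunP => T; rewrite degree_projE ffunE; case: eqP => // Tk.
rewrite ha // Tk; apply: contraNneq oS => <-.
by rewrite -oe oddD addKb.
Qed.

End ComplexForms.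

(** * The Hodge star and the two sesquilinear forms *)

Lemma conjcD (R : rcfType) (x y : R[i]) : (x + y)^*%C = x^*%C + y^*%C.
Proof. exact: rmorphD. Qed.

Lemma conjcM (R : rcfType) (x y : R[i]) : (x * y)^*%C = x^*%C * y^*%C.
Proof. exact: rmorphM. Qed.

Lemma conjc_sum (R : rcfType) (I : Type) (r : seq I) (P : pred I) (F : I -> R[i]) :
  (\sum_(i <- r | P i) F i)^*%C = \sum_(i <- r | P i) (F i)^*%C.
Proof. exact: rmorph_sum. Qed.

Lemma conjcN (R : rcfType) (x : R[i]) : (- x)^*%C = - x^*%C.
Proof. exact: rmorphN. Qed.

Lemma conjc_sign (R : rcfType) (e : bool) : ((-1) ^+ e : R[i])^*%C = (-1) ^+ e.
Proof. exact: rmorph_sign. Qed.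

Lemma conjci (R : rcfType) : ('i%C : R[i])^*%C = - 'i%C.
Proof. by apply/eqP; rewrite eq_complex /= oppr0 !eqxx. Qed.

Section Metric.
Variables (R : realType) (n : nat) (g : 'M[R]_n).
Hypotheses (g_sym : g^T = g) (g_det : 0 < \det g) (n_odd : odd n).
Local Notation C := R[i].
Local Notation form := (extalg C n).
Local Notation operator := 'End(form).
Implicit Types (S T U : {set 'I_n}) (a b c : form) (phi psi : operator).

Local Notation sgn S T := (shuffle_sign C S T : C).
Local Notation vol := ((Num.sqrt (\det g))%:C : C).

Lemma vol_sqr : vol * vol = (\det g)%:C.
Proof. by rewrite -rmorphM -expr2 sqr_sqrtr // ltW. Qed.

Lemma vol_neq0 : vol != 0.
Proof.
apply/eqP => v0; have := vol_sqr; rewrite v0 mul0r => /esym/eqP.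
by rewrite fmorph_eq0 gt_eqF.
Qed.

(** The only possible value of the star: its coefficients are read off from
  dx_S /\ conj (star b) = (dx_S, b) vol.  The subdeterminants are those of the
  inner product on covectors. *)
Definition star b : form :=
  [ffun U : {set 'I_n} => vol * sgn (~: U) U *
     \sum_(T : {set 'I_n} | #|~: U| == #|T|)
        (b T : C) * (subdet (invmx g) (~: U) T)%:C : C].

Lemma star_linear : linear star.
Proof.
move=> x b c; apply/ffunP => U; rewrite !ffunE.
rewrite -[X in _ = X + _]/(x * _) [x * _]mulrCA -mulrDr; congr (_ * _).
rewrite mulr_sumr -big_split /=; apply: eq_bigr => T _.
by rewrite !ffunE mulrDl mulrA.
Qed.

Lemma wedge_star_top a b : wedge a (ext_conj (star b)) setT = vol * herm g a b.
Proof.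
rewrite wedge_top mulr_sumr; apply: eq_bigr => S _; rewrite ext_conjE ffunE setCK.
rewrite !conjcM conj_shuffle_sign conjc_real conjc_sum.
set s := sgn S (~: S); set w := \sum_(T | _) _.
rewrite [LHS](_ : _ = (s * s) * (vol * (a S * w))); last by ring.
rewrite shuffle_sign_sqr mul1r mulr_sumr; congr (_ * _).
by apply: eq_bigr => T _; rewrite conjcM conjc_real mulrA.
Qed.

Lemma subdet_sym S T : #|S| = #|T| -> subdet (invmx g) S T = subdet (invmx g) T S.
Proof. by move=> ST; rewrite -subdet_tr // trmx_inv g_sym. Qed.

Lemma cardsC_ord S : (#|S| + #|~: S| = n)%N.
Proof. by rewrite cardsC card_ord. Qed.

Lemma cardsC_sub S : (n - #|~: S|)%N = #|S|.
Proof. by rewrite -[X in (X - _)%N](cardsC_ord S) addnK. Qed.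

Lemma card_setC_eq S T : (#|~: S| == #|~: T|) = (#|S| == #|T|).
Proof.
have aux (m x x' y y' : nat) : (x + x' = m -> y + y' = m -> (x' == y') = (x == y))%N.
  by move=> ? ?; lia.
exact: aux (cardsC_ord S) (cardsC_ord T).
Qed.

Lemma even_card_mul_cardC S : ~~ odd (#|S| * #|~: S|).
Proof.
by move/(congr1 odd): (cardsC_ord S); rewrite oddD n_odd oddM; case: (odd _).
Qed.

(** Applying the star twice pairs complementary minors of the inverse metric,
  and Laplace's expansion leaves only the diagonal terms, with coefficient
  det g det g^-1 = 1 up to the sign (-1)^(k (n - k)), which is 1 for n odd. *)
Lemma starK : involutive star.
Proof.
move=> b; apply/ffunP => U; rewrite ffunE.
pose G S T : C := (subdet (invmx g) S T)%:C.
have key (V : {set 'I_n}) : #|V| = #|U| ->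
    \sum_(T : {set 'I_n} | #|~: U| == #|T|)
       sgn (~: T) T * G (~: T) V * G (~: U) T =
    (V == U)%:R * sgn V (~: U) * (\det (invmx g))%:C.
  move=> VU.
  have VUn : (#|V| + #|~: U| = n)%N by rewrite VU cardsC_ord.
  have := congr1 (@real_complex R) (laplace (invmx g) VUn).
  rewrite rmorph_sum /= !rmorphM /= -shuffle_signE rmorph_nat.
  rewrite (inj_eq (can_inj (@setCK _))) [U == V]eq_sym => <-.
  rewrite (reindex_inj (can_inj (@setCK _))) /=; apply: eq_big => [T|T].
    by rewrite card_setC_eq eq_sym VU.
  move=> UT; rewrite setCK !rmorphM /= -shuffle_signE /G.
  move: UT; rewrite (card_setC_eq U T) => /eqP UT.
  by rewrite subdet_sym ?setCK // -UT.
have -> : vol * sgn (~: U) U *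
     (\sum_(T : {set 'I_n} | #|~: U| == #|T|)
        (star b T : C) * G (~: U) T) =
  (vol * vol * sgn (~: U) U *
  \sum_(V : {set 'I_n} | #|V| == #|U|) (b V : C) * \sum_(T : {set 'I_n} | #|~: U| == #|T|)
       sgn (~: T) T * G (~: T) V * G (~: U) T) :> C.
  rewrite [RHS](_ : forall x y z : C, x * x * y * z = x * y * (x * z)); last first.
    by move=> x y z; ring.
  congr (_ * _).
  rewrite [in RHS](eq_bigr (fun V : {set 'I_n} => \sum_(T : {set 'I_n} | #|~: U| == #|T|)
     (b V : C) * (sgn (~: T) T * G (~: T) V * G (~: U) T))); last first.
    by move=> V _; rewrite mulr_sumr.
  rewrite exchange_big /= mulr_sumr; apply: eq_bigr => T UT.
  rewrite ffunE -!mulrA; congr (_ * _); rewrite mulr_suml mulr_sumr.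
  apply: eq_big => [V|V _]; last by rewrite /G; ring.
  have /eqP <- : #|U| == #|~: T| by rewrite -card_setC_eq setCK.
  by rewrite eq_sym.
rewrite (bigD1 U) //= key // big1 => [|V /andP[/eqP VU /negPf neVU]].
  rewrite addr0 eqxx mul1r vol_sqr shuffle_signC; last first.
    by rewrite -setI_eq0 setIC setICr.
  rewrite -signr_odd mulnC (negPf (even_card_mul_cardC U)) expr0 mul1r.
  rewrite [LHS](_ : _ = b U * (sgn U (~: U) * sgn U (~: U)) *
    ((\det g)%:C * (\det (invmx g))%:C)); last by ring.
  by rewrite shuffle_sign_sqr mulr1 det_inv -rmorphM /= divff ?mulr1 // gt_eqF.
by rewrite key // neVU !mul0r mulr0.
Qed.

Lemma hermDl a b c : herm g (a + b) c = herm g a c + herm g b c.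
Proof.
rewrite -big_split /=; apply: eq_bigr => S _; rewrite -big_split /=.
by apply: eq_bigr => T _; rewrite !ffunE !mulrDl.
Qed.

Lemma hermZl x a b : herm g (x *: a) b = x * herm g a b.
Proof.
rewrite mulr_sumr; apply: eq_bigr => S _; rewrite mulr_sumr.
by apply: eq_bigr => T _; rewrite !ffunE !mulrA.
Qed.

Lemma herm_conj a b : herm g a b = (herm g b a)^*%C.
Proof.
rewrite /herm conjc_sum.
under eq_bigr => S _ do rewrite big_mkcond.
rewrite exchange_big /=; apply: eq_bigr => T _.
rewrite conjc_sum -big_mkcond; apply: eq_big => [S|S /eqP ST].
  by rewrite eq_sym.
by rewrite !conjcM conjcK conjc_real subdet_sym // [a S * _]mulrC.
Qed.

Lemma hermDr a b c : herm g a (b + c) = herm g a b + herm g a c.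
Proof. by rewrite herm_conj hermDl conjcD -!herm_conj. Qed.

Lemma hermZr x a b : herm g a (x *: b) = x^*%C * herm g a b.
Proof. by rewrite herm_conj hermZl conjcM -herm_conj. Qed.

Lemma herm_suml I (r : seq I) (P : pred I) F b :
  herm g (\sum_(i <- r | P i) F i) b = \sum_(i <- r | P i) herm g (F i) b.
Proof.
apply: (big_morph (fun x => herm g x b)) => [x y|]; first exact: hermDl.
by rewrite -(scale0r (0 : form)) hermZl mul0r.
Qed.

Lemma herm_sumr I (r : seq I) (P : pred I) F a :
  herm g a (\sum_(i <- r | P i) F i) = \sum_(i <- r | P i) herm g a (F i).
Proof.
rewrite herm_conj herm_suml conjc_sum.
by apply: eq_bigr => i _; rewrite -herm_conj.
Qed.

Lemma herm_parity s t a b : form_parity s a -> form_parity t b -> s != t -> herm g a b = 0.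
Proof.
move=> ha hb st; rewrite /herm big1 // => S _; rewrite big1 // => T /eqP ST.
have [oS|/ha ->] := eqVneq (odd #|S|) s; last by rewrite !mul0r.
by rewrite hb ?rmorph0 ?mulr0 ?mul0r // -ST oS.
Qed.

Lemma complexify_volumeE T :
  complexify (volume_form g) T = if T == setT then vol else 0.
Proof. by rewrite !ffunE; case: ifP. Qed.

(** Up to the normalization of the volume form, the pairing is the top
  coefficient of a wedge product. *)
Lemma pairingE a b : pairing g a b = vol^-1 * wedge a (ext_conj b) setT.
Proof.
rewrite /pairing /herm (bigD1 setT) //= [X in _ + X]big1 => [|S ST]; last first.
  rewrite big1 // => T /eqP cST; rewrite complexify_volumeE ifN.
    by rewrite conjc0 mulr0 mul0r.
  apply: contra_neq ST => TT; apply/eqP.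
  by rewrite eqEcard finset.subsetT cST TT leqnn.
rewrite addr0 (bigD1 setT) //= [X in _ + X]big1 => [|T /andP[_ TT]]; last first.
  by rewrite complexify_volumeE ifN // conjc0 mulr0 mul0r.
rewrite addr0 complexify_volumeE eqxx conjc_real subdet_top det_inv.
rewrite -mulrA mulrC; congr (_ * _).
apply: (mulfI vol_neq0); rewrite mulrA vol_sqr divff ?vol_neq0 //.
by rewrite -rmorphM /= divff // gt_eqF.
Qed.

Lemma pairing_star a b : pairing g a b = herm g a (star b).
Proof.
by rewrite pairingE -{1}(starK b) wedge_star_top mulKf // vol_neq0.
Qed.

Lemma herm_star a b : herm g a b = pairing g a (star b).
Proof. by rewrite pairing_star starK. Qed.

(** Nondegeneracy: by the defining property of the star, the numbers (dx_S, b)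
  are, up to nonzero factors, the coefficients of star b. *)
Lemma herm_eq b c : (forall S, herm g (dx R S) b = herm g (dx R S) c) -> b = c.
Proof.
move=> bc; apply: (can_inj starK); apply/ffunP => U.
apply: (can_inj (@conjcK R)).
have := congr1 ( *%R vol) (bc (~: U)).
rewrite -!wedge_star_top !wedge_dx_top setCK !ffunE => h.
have := congr1 ( *%R (sgn (~: U) U)) h.
by rewrite !mulrA shuffle_sign_sqr !mul1r.
Qed.

(** The pairing with c reads off the coefficients of c, so each functional
  a |-> (phi a, b) is the pairing with an explicit form c b, that is, the
  product with star (c b). *)
Lemma herm_adjoint_ex phi :
  exists psi, forall a b, herm g (phi a) b = herm g a (psi b).
Proof.
pose c b : form := [ffun U : {set 'I_n} =>
  (vol * sgn (~: U) U * herm g (phi (dx R (~: U))) b)^*%C].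
have lc : linear (fun b => star (c b)).
  move=> x a b; rewrite -star_linear; congr (star _); apply/ffunP => U.
  rewrite !ffunE hermDr hermZr !(rmorphM, rmorphD) /= conjcK.
  rewrite mulrDr; congr (_ + _); exact: mulrCA.
exists (linfun (fun b => star (c b))) => a b; rewrite linfunE //.
rewrite -pairing_star pairingE wedge_top {1}(form_sum_dx a) linear_sum /= herm_suml.
rewrite mulr_sumr; apply: eq_bigr => S _.
rewrite linearZ hermZl !ffunE conjcK setCK.
rewrite [RHS](_ : _ = (vol^-1 * vol) * (sgn S (~: S) * sgn S (~: S))
   * (a S * herm g (phi (dx R S)) b)); last by ring.
by rewrite shuffle_sign_sqr mulVf ?vol_neq0 // !mul1r.
Qed.

Lemma is_hodge_star_star : is_hodge_star g (linfun star).
Proof.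
move=> k kn; split=> [b hb U Uk|a b ha hb]; rewrite linfunE; try exact: star_linear.
  rewrite ffunE big1 ?mulr0 // => T /eqP UT; rewrite hb ?mul0r //.
  apply: contra_neq Uk => Tk; rewrite -Tk -UT.
  by rewrite cardsC_sub.
have hw : homogeneous n (wedge a (ext_conj (star b))).
  have := wedge_homogeneous (k := k) (l := n - k) (b := ext_conj (star b)) ha.
  rewrite subnKC //; apply; apply: ext_conj_homogeneous => U Uk.
  rewrite ffunE big1 ?mulr0 // => T /eqP UT; rewrite hb ?mul0r //.
  apply: contra_neq Uk => Tk; rewrite -Tk -UT.
  by rewrite cardsC_sub.
apply/ffunP => U; rewrite [RHS]ffunE complexify_volumeE; case: eqP => [->|UT].
  by rewrite wedge_star_top mulrC.
rewrite hw ?scaler0 //; apply/eqP => Un; apply: UT; apply/eqP.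
by rewrite eqEcard finset.subsetT cardsT card_ord Un leqnn.
Qed.

Lemma starN b : star (- b) = - star b.
Proof. by rewrite -!(linfunE star_linear) linearN. Qed.

(** The star is unique: testing against dx_S reads off each coefficient. *)
Lemma hodgeE b : hodge g b = star b.
Proof.
suff -> : hodge g = linfun star by rewrite linfunE //; apply: star_linear.
have ex : exists phi, is_hodge_star g phi by exists (linfun star); apply: is_hodge_star_star.
have hh : is_hodge_star g (hodge g) := xgetPex 0 ex.
apply/lfunP => c; rewrite (form_sum_dx c) !linear_sum; apply: eq_bigr => S _.
rewrite !linearZ; congr (_ *: _).
have Sn : (#|S| <= n)%N := card_ltnS S.
have [h1 h2] := hh _ Sn; have [s1 s2] := is_hodge_star_star Sn.
have hS := @dx_homogeneous R n S.
apply/ffunP => U; have [US|US] := eqVneq #|U| (n - #|S|)%N; last first.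
  by rewrite h1 ?s1.
have hU : homogeneous #|S| (dx R (~: U)).
  have -> : #|S| = #|~: U|; last exact: dx_homogeneous.
  by apply: (@addnI #|U|); rewrite cardsC_ord US subnK.
have := congr1 (fun w : form => w setT) (h2 _ _ hU hS).
rewrite -(s2 _ _ hU hS) !wedge_dx_top setCK !ext_conjE => e.
apply: (can_inj (@conjcK R)).
have := congr1 ( *%R (sgn (~: U) U)) e.
by rewrite !mulrA shuffle_sign_sqr !mul1r.
Qed.

Lemma star_parity s b : form_parity s b -> form_parity (~~ s) (star b).
Proof.
move=> hb U Us; rewrite ffunE big1 ?mulr0 // => T /eqP UT; rewrite hb ?mul0r // -UT.
move/(congr1 odd): (cardsC_ord U); rewrite oddD n_odd.
by clear hb; move: Us; case: (odd #|U|); case: (odd #|~: U|); case: s.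
Qed.

(** The dimension is odd, so only forms of opposite parities can multiply to a
  top form. *)
Lemma pairing_parity s t a b : form_parity s a -> form_parity t b -> s = t -> pairing g a b = 0.
Proof.
move=> ha hb st; rewrite pairing_star; apply: (herm_parity ha (star_parity hb)).
by rewrite st; case: (t).
Qed.

Lemma pairing_homogeneous k l a b : homogeneous k a -> homogeneous l b ->
  (k + l)%N != n -> pairing g a b = 0.
Proof.
move=> ha hb kl; rewrite pairingE wedge_top big1 ?mulr0 // => S _.
have [kS|/ha ->] := eqVneq #|S| k; last by rewrite mulr0 mul0r.
rewrite ext_conjE (hb (~: S)) ?conjc0 ?mulr0 //.
by apply: contra_neq kl => <-; rewrite -kS cardsC_ord.
Qed.

Lemma pairingDl a b c : pairing g (a + b) c = pairing g a c + pairing g b c.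
Proof. by rewrite !pairing_star hermDl. Qed.

Lemma pairingZl x a b : pairing g (x *: a) b = x * pairing g a b.
Proof. by rewrite !pairing_star hermZl. Qed.

Lemma pairingDr a b c : pairing g a (b + c) = pairing g a b + pairing g a c.
Proof. by rewrite !pairingE ext_conjD wedgeDr ffunE mulrDr. Qed.

Lemma pairingZr x a b : pairing g a (x *: b) = x^*%C * pairing g a b.
Proof. by rewrite !pairingE ext_conjZ wedgeZr ffunE mulrCA. Qed.

Lemma pairing0l b : pairing g 0 b = 0.
Proof. by rewrite -(scale0r (0 : form)) pairingZl mul0r. Qed.

Lemma pairing0r a : pairing g a 0 = 0.
Proof. by rewrite -(scale0r (0 : form)) pairingZr conjc0 mul0r. Qed.

Lemma pairing_suml I (r : seq I) (P : pred I) F b :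
  pairing g (\sum_(i <- r | P i) F i) b = \sum_(i <- r | P i) pairing g (F i) b.
Proof.
apply: (big_morph (fun x => pairing g x b)) => [x y|]; first exact: pairingDl.
exact: pairing0l.
Qed.

Lemma pairing_sumr I (r : seq I) (P : pred I) F a :
  pairing g a (\sum_(i <- r | P i) F i) = \sum_(i <- r | P i) pairing g a (F i).
Proof.
apply: (big_morph (pairing g a)) => [x y|]; first exact: pairingDr.
exact: pairing0r.
Qed.

(** * The pairing in terms of parities *)

(** Preservation without homogeneous components of [phi]: for a and b of degrees
  k and l only the component of degree d = n - k - l of [phi] contributes, and
  k d is congruent to k l modulo 2. *)
Definition preserves phi := forall s t a b, form_parity s a -> form_parity t b ->
  pairing g (phi a) b + (-1) ^+ (s && t) * pairing g a (phi b) = 0.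

Lemma preserves_from_homogeneous phi :
  (forall k l a b, homogeneous k a -> homogeneous l b ->
     pairing g (phi a) b + (-1) ^+ (odd k && odd l) * pairing g a (phi b) = 0) ->
  preserves phi.
Proof.
move=> h s t a b ha hb.
rewrite (form_parity_sum ha) (form_parity_sum hb) !linear_sum /=.
rewrite !pairing_suml mulr_sumr -big_split /= big1 // => k /eqP ks.
rewrite !pairing_sumr mulr_sumr -big_split /= big1 // => l /eqP lt.
by rewrite -ks -lt; apply: h; exact: degree_proj_homogeneous.
Qed.

Lemma pairing_component d phi k l a b : homogeneous k a -> homogeneous l b ->
  pairing g (component d phi a) b =
  if (k + l)%:Z + d == n%:Z then pairing g (phi a) b else 0.
Proof.
move=> ha hb; rewrite !pairingE !wedge_top.
case: ifP => kl; last rewrite big1 ?mulr0 // => [S _].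
  congr (_ * _); apply: eq_bigr => S _; rewrite (componentE _ _ _ ha).
  case: eqP => // Sd; rewrite !ext_conjE (hb (~: S)) ?conjc0 ?mulr0 //.
  by apply/eqP => Sl; apply: Sd; have := cardsC_ord S; rewrite Sl; move/eqP: kl; lia.
rewrite (componentE _ _ _ ha); case: eqP => [Sd|]; last by rewrite mulr0 mul0r.
rewrite !ext_conjE (hb (~: S)) ?conjc0 ?mulr0 //.
by apply: contraFN kl => /eqP <-; have := cardsC_ord S; lia.
Qed.

Lemma pairing_componentr d phi k l a b : homogeneous k a -> homogeneous l b ->
  pairing g a (component d phi b) =
  if (k + l)%:Z + d == n%:Z then pairing g a (phi b) else 0.
Proof.
move=> ha hb; rewrite !pairingE !wedge_top.
case: ifP => kl; last rewrite big1 ?mulr0 // => [S _].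
  congr (_ * _); apply: eq_bigr => S _; rewrite !ext_conjE (componentE _ _ _ hb).
  case: eqP => // Sd; rewrite (ha S) ?mulr0 ?mul0r //.
  by apply/eqP => Sl; apply: Sd; have := cardsC_ord S; rewrite Sl; move/eqP: kl; lia.
rewrite !ext_conjE (componentE _ _ _ hb); case: eqP => [Sd|]; last by rewrite conjc0 mulr0.
rewrite (ha S) ?mulr0 ?mul0r //.
by apply: contraFN kl => /eqP <-; have := cardsC_ord S; lia.
Qed.

(** k d = k (n - k - l), where n is odd and k (k + 1) is even. *)
Lemma odd_degree_shift k l d :
  (k + l)%:Z + d = n%:Z -> odd (k * `|d|) = odd k && odd l.
Proof.
have aux m : odd (k + l) = ~~ odd m -> odd (k * m) = odd k && odd l.
  by rewrite oddM oddD; case: (odd k); case: (odd l); case: (odd m).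
case: d => m kl; apply: aux.
  have /(congr1 odd) : (k + l + m = n)%N by lia.
  by rewrite oddD n_odd; case: (odd (k + l)); case: (odd m).
have /(congr1 odd) : (k + l = n + m.+1)%N by lia.
by rewrite [in X in _ = X]oddD n_odd => ->.
Qed.

Lemma preserves_pairingP phi : preserves_pairing g phi <-> preserves phi.
Proof.
split=> h.
  apply: preserves_from_homogeneous => k l a b ha hb.
  have := h (n%:Z - (k + l)%:Z) k l a b ha hb.
  rewrite (pairing_component _ _ ha hb) (pairing_componentr _ _ ha hb).
  have kl : (k + l)%:Z + (n%:Z - (k + l)%:Z) = n%:Z by rewrite addrC subrK.
  rewrite kl eqxx => <-; congr (_ + _ * _).
  by rewrite -[RHS]signr_odd (odd_degree_shift kl).
move=> d k l a b ha hb.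
rewrite (pairing_component _ _ ha hb) (pairing_componentr _ _ ha hb).
case: eqP => kl; last by rewrite mulr0 addr0.
rewrite -(h _ _ _ _ (homogeneous_parity ha) (homogeneous_parity hb)).
congr (_ + _ * _).
by rewrite -[LHS]signr_odd (odd_degree_shift kl).
Qed.

(** * The adjoint in terms of parities *)

Lemma herm_component d phi k l a b : homogeneous k a -> homogeneous l b ->
  herm g (component d phi a) b =
  if l%:Z == k%:Z + d then herm g (phi a) b else 0.
Proof.
move=> ha hb; case: ifPn => kl; last first.
  rewrite /herm big1 // => S _; rewrite big1 // => T /eqP ST.
  rewrite (componentE _ _ _ ha); case: eqP => Sd; last by rewrite !mul0r.
  rewrite (hb T) ?conjc0 ?mulr0 ?mul0r // -ST.
  by apply: contraNneq kl => <-; rewrite Sd.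
rewrite /herm; apply: eq_bigr => S _; apply: eq_bigr => T /eqP ST.
rewrite (componentE _ _ _ ha); case: eqP => // Sd.
rewrite (hb T) ?conjc0 ?mulr0 ?mul0r // -ST.
by apply/eqP => Sl; apply: Sd; rewrite Sl (eqP kl).
Qed.

(** Existence of the signed adjoint: it is the adjoint, in the usual sense, of
  [phi] composed with the sign operator on homogeneous forms. *)
Lemma adjoint_homogeneousP d phi :
  is_adjoint g d phi (adjoint_homogeneous g d phi).
Proof.
apply: xgetPex.
(* the sign operator, (-1)^(|d| k) on forms of degree k *)
pose eps : operator := \sum_(k < n.+1) (-1) ^+ (`|d| * k) *: degree_proj R n k.
have epsE k a : homogeneous k a -> eps a = (-1) ^+ (`|d| * k) *: a.
  move=> ha; apply/ffunP => S; rewrite sum_lfunE sum_ffunE.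
  have Sn := card_ltnS S.
  rewrite (bigD1 (Ordinal Sn)) //= big1 => [|l lS].
    rewrite scale_lfunE ffunE degree_projE eqxx addr0 ffunE.
    by have [->//|/ha ->] := eqVneq #|S| k; rewrite !scaler0.
  rewrite scale_lfunE ffunE degree_projE; case: eqP => [e|_]; last by rewrite scaler0.
  by case/eqP: lS; apply: val_inj.
have [psi psiP] := herm_adjoint_ex (phi \o eps)%VF.
exists psi => k l a b ha hb.
by rewrite -psiP lfunE /= (epsE _ _ ha) linearZ hermZl mulrA -expr2 sqrr_sign mul1r.
Qed.

Lemma hermNr a b : herm g a (- b) = - herm g a b.
Proof. by rewrite -scaleN1r hermZr rmorphN1 mulN1r. Qed.

(** As for the pairing, only the component of [phi] of degree d = l - k
  contributes for a and b of degrees k and l, and k d is congruent to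
  k (l + 1). *)
Lemma adjointP phi s t a b : form_parity s a -> form_parity t b ->
  herm g (phi a) b = (-1) ^+ (s && ~~ t) * herm g a (adjoint g phi b).
Proof.
move=> ha hb; rewrite (form_parity_sum ha) (form_parity_sum hb).
rewrite !linear_sum /= !herm_suml mulr_sumr; apply: eq_bigr => k /eqP ks.
rewrite !herm_sumr mulr_sumr; apply: eq_bigr => l /eqP lt.
have := @degree_proj_homogeneous R n l b; have := @degree_proj_homogeneous R n k a.
move: (degree_proj R n k a) (degree_proj R n l b) => {ha hb}a {}b ha hb.
rewrite /adjoint sum_lfunE herm_sumr /=.
(* the index of the component of degree l - k in the sum over 0 <= m <= 2 n *)
have km : (l + (n - k) < n.*2.+1)%N by have := ltn_ord k; have := ltn_ord l; lia.
have kml : l%:Z = k%:Z + ((l + (n - k))%:Z - n%:Z) by have := ltn_ord k; lia.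
have adjE (m : 'I_n.*2.+1) : herm g a (adjoint_homogeneous g (m%:Z - n%:Z)
     (component (m%:Z - n%:Z) phi) b) =
   (-1) ^+ (`|m%:Z - n%:Z| * k) * if l%:Z == k%:Z + (m%:Z - n%:Z) then herm g (phi a) b else 0.
  rewrite -(herm_component _ _ ha hb) (@adjoint_homogeneousP (m%:Z - n%:Z) (component (m%:Z - n%:Z) phi) _ _ _ _ ha hb).
  by rewrite mulrA -expr2 sqrr_sign mul1r.
rewrite (eq_bigr _ (fun m _ => adjE m)) (bigD1 (Ordinal km)) // big1 => [|m mk]; last first.
  case: eqP => [e|_]; last by rewrite mulr0.
  by case/eqP: mk; apply: val_inj => /=; lia.
rewrite [X in _ * X]addr0 [nat_of_ord (Ordinal km)]/= -kml eqxx mulrA.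
rewrite -(signr_odd _ (`|(l + (n - k))%:Z - n%:Z| * k)).
suff -> : odd (`|(l + (n - k))%:Z - n%:Z| * k) = s && ~~ t.
  by rewrite -expr2 sqrr_sign mul1r.
rewrite -ks -lt oddM.
have : odd `|(l + (n - k))%:Z - n%:Z| = odd (l + k).
  have [kl|lk] := leqP k l.
    have -> : `|(l + (n - k))%:Z - n%:Z|%N = (l - k)%N by have := ltn_ord k; lia.
    by rewrite oddB // oddD.
  have -> : `|(l + (n - k))%:Z - n%:Z|%N = (k - l)%N by have := ltn_ord k; lia.
  by rewrite oddB 1?ltnW // oddD addbC.
by move=> ->; rewrite oddD; case: (odd k); case: (odd l).
Qed.

Lemma adjoint_unique phi psi :
  (forall s t a b, form_parity s a -> form_parity t b ->
     herm g (phi a) b = (-1) ^+ (s && ~~ t) * herm g a (psi b)) ->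
  adjoint g phi = psi.
Proof.
move=> h; apply/lfunP => b; rewrite (form_sum_dx b) !linear_sum.
apply: eq_bigr => T _; rewrite !linearZ; congr (_ *: _); apply: herm_eq => S.
have hS := homogeneous_parity (@dx_homogeneous R n S).
have hT := homogeneous_parity (@dx_homogeneous R n T).
have sgn0 : (-1) ^+ (odd #|S| && ~~ odd #|T|) != 0 :> C by rewrite signr_eq0.
apply: (mulfI sgn0).
by rewrite -(adjointP _ hS hT) (h _ _ _ _ hS hT).
Qed.

(** Replace b by star b, which turns <_, star b> into (_, b) and the parity of b
  into the opposite one. *)
Lemma preserves_adjoint phi :
  preserves phi <-> adjoint g phi = - (hodge g \o (phi \o hodge g))%VF.
Proof.
have starE b : (hodge g \o (phi \o hodge g))%VF b = star (phi (star b)).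
  by rewrite !comp_lfunE !hodgeE.
split=> h.
  apply: adjoint_unique => s t a b ha hb; rewrite opp_lfunE starE hermNr mulrN.
  rewrite -pairing_star herm_star; apply/eqP; rewrite -addr_eq0.
  by rewrite (h _ _ _ _ ha (star_parity hb)).
move=> s t a b ha hb; rewrite pairing_star (adjointP _ ha (star_parity hb)) h.
by rewrite opp_lfunE starE starK hermNr negbK mulrN -pairing_star addNr.
Qed.

(** * Stability under brackets and adjoints *)

Definition op_parity (e : bool) phi := forall s a, form_parity s a -> form_parity (s (+) e) (phi a).

Lemma preserves0 : preserves 0.
Proof. by move=> s t a b _ _; rewrite !lfunE pairing0l pairing0r mulr0 addr0. Qed.

Lemma preservesD phi psi : preserves phi -> preserves psi -> preserves (phi + psi).
Proof.
move=> h1 h2 s t a b ha hb; rewrite !add_lfunE pairingDl pairingDr mulrDr addrACA.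
by rewrite (h1 _ _ _ _ ha hb) (h2 _ _ _ _ ha hb) addr0.
Qed.

Lemma preservesZ (r : R) phi : preserves phi -> preserves (r%:C *: phi).
Proof.
move=> h s t a b ha hb; rewrite !scale_lfunE pairingZl pairingZr conjc_real mulrCA.
by rewrite -mulrDr (h _ _ _ _ ha hb) mulr0.
Qed.

(** Moving both operators across the pairing reverses their order, and the
  accumulated sign differs from (-1)^(s t + e f) by (-1)^((s + f)(t + e)).  The
  pairing vanishes unless s + t + e + f is odd, and then (s + f)(t + e) is
  even. *)
Lemma preserves_bracket e f phi psi :
  op_parity e phi -> op_parity f psi -> preserves phi -> preserves psi ->
  preserves ((phi \o psi)%VF - (-1) ^+ (e && f) *: (psi \o phi)%VF).
Proof.
move=> pe pf h1 h2 s t a b ha hb.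
have bracketE c : ((phi \o psi)%VF - (-1) ^+ (e && f) *: (psi \o phi)%VF) c =
    phi (psi c) + (- (-1) ^+ (e && f)) *: psi (phi c).
  by rewrite add_lfunE opp_lfunE scale_lfunE !comp_lfunE scaleNr.
rewrite !bracketE pairingDl pairingDr !pairingZl !pairingZr.
have hx := pe _ _ ha; have hy := pf _ _ ha.
have hx' := pe _ _ hb; have hy' := pf _ _ hb.
have/eqP := h1 _ _ _ _ hy hb; rewrite addr_eq0 => /eqP ->.
have/eqP := h2 _ _ _ _ ha hx'; rewrite addr_eq0 => /eqP ->.
have/eqP := h2 _ _ _ _ hx hb; rewrite addr_eq0 => /eqP ->.
have/eqP := h1 _ _ _ _ ha hy'; rewrite addr_eq0 => /eqP ->.
rewrite conjcN conjc_sign.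
have [st|st] := eqVneq s (t (+) f (+) e).
  have hb1 := pe _ _ hy'; have hb2 := pf _ _ hx'; rewrite addbAC in hb2.
  by rewrite (pairing_parity ha hb1 st) (pairing_parity ha hb2 st) !(mulr0, oppr0, addr0).
move: (pairing g a (psi (phi b))) (pairing g a (phi (psi b))) => x y.
case: s t e f st {ha hb pe pf hx hy hx' hy' bracketE} => [] [] [] [] //= _;
  rewrite ?expr0 ?expr1; ring.
Qed.

Lemma parity_part_parity e phi : op_parity e (parity_part e phi).
Proof. by move=> s a ha S /negPf Se; rewrite (parity_partE _ _ _ ha) Se. Qed.

(** Between forms of parities s and t only the parity part s + t + 1 of [phi]
  contributes to the pairing. *)
Lemma parity_part_preserves e phi : preserves phi -> preserves (parity_part e phi).
Proof.
move=> h s t a b ha hb.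
have pp := @parity_part_parity e phi.
have [st|st] := eqVneq (s (+) e) t.
  rewrite (pairing_parity (pp _ _ ha) hb st) (pairing_parity ha (pp _ _ hb)).
    by rewrite mulr0 addr0.
  by rewrite -st addbK.
have split u c : form_parity u c -> phi c = parity_part e phi c + parity_part (~~ e) phi c.
  move=> hc; apply/ffunP => S; rewrite ffunE !(parity_partE _ _ _ hc).
  by case: (odd _) (u) (e) => [] [] []; rewrite ?addr0 ?add0r.
have st' : s (+) ~~ e = t by case: s t e st {ha hb pp split} => [] [] [].
have ts' : s = t (+) ~~ e by rewrite -st' addbK.
have pp' := @parity_part_parity (~~ e) phi.
rewrite -[RHS](h _ _ _ _ ha hb) (split _ _ ha) (split _ _ hb) pairingDl pairingDr.
by rewrite (pairing_parity (pp' _ _ ha) hb st') (pairing_parity ha (pp' _ _ hb) ts') !addr0.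
Qed.

Lemma preserves_sum I (r : seq I) (P : pred I) F :
  (forall i, P i -> preserves (F i)) -> preserves (\sum_(i <- r | P i) F i).
Proof. by apply: big_ind; [exact: preserves0 | exact: preservesD]. Qed.

Lemma supercommutator_preserves phi psi :
  preserves phi -> preserves psi -> preserves (supercommutator phi psi).
Proof.
move=> h1 h2; apply: preserves_sum => e _; apply: preserves_sum => f _.
by apply: preserves_bracket; [exact: parity_part_parity.. | |];
  apply: parity_part_preserves.
Qed.

Lemma adjointZ x phi : adjoint g (x *: phi) = x^*%C *: adjoint g phi.
Proof.
apply: adjoint_unique => s t a b ha hb.
by rewrite !scale_lfunE hermZl hermZr conjcK (adjointP _ ha hb) mulrCA.
Qed.

(** Conjugating <phi^star a, b> = (phi^star a, star b) and using
  phi star = - star phi^star gives - (-1)^((1 + s)(1 + t)) <a, phi^star b>.  When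
  both sides do not vanish, s + t + e is odd, and this sign differs from the
  wanted - (-1)^(s t) by (-1)^e; the factor i, which changes sign from one
  variable to the other, compensates for it when e is odd. *)
Lemma adjoint_preserves e phi : preserves phi -> op_parity e phi ->
  preserves ((if e then 'i%C else 1) *: adjoint g phi).
Proof.
move=> h pe; have adjE b : star (adjoint g phi b) = - phi (star b).
  have /preserves_adjoint -> := h.
  rewrite opp_lfunE !comp_lfunE !hodgeE.
  by rewrite starN starK.
have adj_parity : op_parity e (adjoint g phi).
  move=> s a ha; rewrite -[adjoint _ _ _]starK adjE starN.
  have := star_parity (pe _ _ (star_parity ha)).
  by rewrite addNb negbK => hs S /hs; rewrite [in X in _ -> X]ffunE => ->; rewrite oppr0.
move=> s t a b ha hb; rewrite !scale_lfunE pairingZl pairingZr.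
have -> : pairing g (adjoint g phi a) b =
    - ((-1) ^+ (~~ t && ~~ s) * pairing g a (adjoint g phi b)).
  rewrite !pairing_star adjE hermNr mulrN opprK [LHS]herm_conj.
  have := adjointP phi (star_parity hb) ha; move/(congr1 ( *%R ((-1) ^+ (~~ t && ~~ s)))).
  rewrite mulrA -expr2 sqrr_sign mul1r => <-.
  by rewrite conjcM conjc_sign -herm_conj.
have [st|st] := eqVneq s (t (+) e).
  by rewrite (pairing_parity ha (adj_parity _ _ hb) st) !(mulr0, oppr0, addr0).
have -> : (if e then 'i%C else 1 : C)^*%C = (-1) ^+ e * (if e then 'i%C else 1).
  by case: (e); rewrite ?conjci ?conjc1 ?expr0 ?expr1 ?mulN1r ?mul1r.
move: (if e then _ else _) (pairing g a _) => x y.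
case: s t e st {h pe adjE adj_parity ha hb} => [] [] [] //= _;
  rewrite ?expr0 ?expr1; ring.
Qed.

Lemma wedge_op_parity k (w : extalg R n) (x : C) :
  homogeneous k w -> op_parity (odd k) (x *: wedge_op w).
Proof.
move=> hw s a ha; rewrite (form_parity_sum ha) linear_sum /= => S Ss.
rewrite sum_ffunE big1 // => l /eqP ls.
rewrite scale_lfunE ffunE wedge_opE (wedge_homogeneous (k := k) (l := l)) ?scaler0 //.
- exact: complexify_homogeneous.
- exact: degree_proj_homogeneous.
by apply: contra_neq Ss => ->; rewrite oddD ls addbC.
Qed.

(** In a /\ w /\ conj b, moving w across a costs (-1)^(k l), and if the product
  is a top form then k l is congruent to l m; the two terms cancel because i
  comes out of the second variable as - i. *)
Lemma wedge_op_preserves k (w : extalg R n) :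
  homogeneous k w -> preserves ('i%C *: wedge_op w).
Proof.
move=> hw; apply: preserves_from_homogeneous => l m a b ha hb.
have hc := complexify_homogeneous hw.
have [klm|klm] := eqVneq (k + l + m)%N n; last first.
  rewrite !scale_lfunE pairingZl pairingZr !wedge_opE.
  rewrite (pairing_homogeneous (wedge_homogeneous hc ha) hb klm).
  rewrite (pairing_homogeneous ha (wedge_homogeneous hc hb)) ?mulr0 ?addr0 //.
  by rewrite addnCA addnA.
rewrite !scale_lfunE pairingZl pairingZr !wedge_opE !pairingE ext_conj_wedge.
rewrite ext_conj_complexify conjci (wedgeC hc ha) wedgeZl ffunE wedgeA.
rewrite -signr_odd oddM.
have -> : odd k && odd l = odd l && odd m.
  move/(congr1 odd): klm; rewrite !oddD n_odd.
  by case: (odd k); case: (odd l); case: (odd m).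
rewrite -[_ *: _]/(_ * _).
by ring.
Qed.

End Metric.

(** * The generators *)

Section WSD.
Variables (R : realType) (X : wsd_manifold R).
Implicit Types (p : X) (j : 'I_3).

Lemma metric_sym p : (metric p)^T = metric p.
Proof. by case: (metric_riemannian X). Qed.

(** The matrix M of an orthonormal coframe satisfies M g^-1 M^T = 1, so that
  det g = (det M)^2. *)
Lemma adapted_coframe_det (g : 'M[R]_9) w1 w2 wD v :
  adapted_coframe g w1 w2 wD v -> 0 < \det g.
Proof.
case=> ortho _ _ _.
have e : 9 = #|{: 'I_3 * 'I_3}| by rewrite card_prod !card_ord.
pose f (k : 'I_9) : 'I_3 * 'I_3 := enum_val (cast_ord e k).
have f_inj : injective f by move=> k l /enum_val_inj /cast_ord_inj.
pose M := \matrix_k v (f k).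
have : \det (M *m invmx g *m M^T) = 1.
  rewrite (_ : _ *m M^T = 1%:M) ?det1 //; apply/matrixP => k l.
  rewrite [1%:M _ _]mxE -(inj_eq f_inj) -ortho.
  rewrite /covector_product !mxE; apply: eq_bigr => i _; rewrite !mxE; congr (_ * _).
  by apply: eq_bigr => j _; rewrite !mxE.
rewrite !det_mulmx det_tr det_inv mulrAC => dM.
rewrite -invr_gt0; have : 0 < \det M * \det M * (\det g)^-1 by rewrite dM ltr01.
rewrite pmulr_rgt0 // -expr2 exprn_even_gt0 //=.
by apply: contra_eq_neq dM => ->; rewrite !mul0r eq_sym oner_eq0.
Qed.

Lemma metric_det p : 0 < \det (metric p).
Proof. by case: (adapted_coframe_exists p) => v /adapted_coframe_det. Qed.

Lemma Vol_homogeneous j p : homogeneous 3 (Vol j p).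
Proof.
apply: (wedge_homogeneous (k := 1) (l := 2)); first exact: one_form_homogeneous.
by apply: (wedge_homogeneous (k := 1) (l := 1)); exact: one_form_homogeneous.
Qed.

Lemma opL_wedge_op j p : exists (r : R) (w : extalg R 9),
  homogeneous 2 w /\ opL j p = r%:C%C *: wedge_op w.
Proof.
have -> : opL j p = nth 0 [:: wedge_op (omegaD p); - wedge_op (omega2 p);
  wedge_op (omega1 p)] j by rewrite /opL (tnth_nth 0).
case: j => -[|[|[|//]]] _ /=.
- by exists 1, (omegaD p); split; [exact: omegaD_degree | rewrite scale1r].
- exists (-1), (omega2 p); split; [exact: omega2_degree|].
  by rewrite rmorphN1 scaleN1r.
- by exists 1, (omega1 p); split; [exact: omega1_degree | rewrite scale1r].
Qed.

Lemma L3_preserves (Phi : X -> 'End(extalg R[i] 9)) p :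
  L3 Phi -> preserves (metric p) (Phi p).
Proof.
have odd9 : odd 9 by [].
move=> L3Phi; move: p.
apply: (L3Phi (fun Psi => forall q, preserves (metric q) (Psi q))); split.
  split=> [p|P Q hP hQ p|r P hP p|P Q hP hQ p].
  - exact: (preserves0 (metric_sym p) (metric_det p) odd9).
  - exact: (preservesD (metric_sym p) (metric_det p) odd9 (hP p) (hQ p)).
  - exact: (preservesZ (metric_sym p) (metric_det p) odd9 _ (hP p)).
  - exact: (supercommutator_preserves (metric_sym p) (metric_det p) odd9 (hP p) (hQ p)).
have opL_preserves j p : preserves (metric p) ('i%C *: opL j p).
  have [r [w [hw ->]]] := opL_wedge_op j p; rewrite scalerA mulrC -scalerA.
  exact: (preservesZ (metric_sym p) (metric_det p) odd9 _
    (wedge_op_preserves (metric_sym p) (metric_det p) odd9 hw)).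
move=> _ [[[|]|]|] [j _ <-] p.
- exact: opL_preserves.
- exact: (wedge_op_preserves (metric_sym p) (metric_det p) odd9 (Vol_homogeneous j p)).
- have par : op_parity false ('i%C *: opL j p).
    have [r [w [hw ->]]] := opL_wedge_op j p; rewrite scalerA; exact: (wedge_op_parity _ hw).
  (* the adjoint of i L_j is - i Lambda_j *)
  have := adjoint_preserves (metric_sym p) (metric_det p) odd9 (opL_preserves j p) par.
  rewrite (adjointZ (metric_sym p) (metric_det p) odd9) conjci.
  rewrite scale1r scaleNr => h.
  have := preservesZ (metric_sym p) (metric_det p) odd9 (-1) h.
  by rewrite rmorphN1 scaleN1r opprK.
- have hV := Vol_homogeneous j p.
  (* the adjoint of i V_j is - i A_j, and i (- i A_j) = A_j *)
  have := adjoint_preserves (metric_sym p) (metric_det p) odd9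
    (wedge_op_preserves (metric_sym p) (metric_det p) odd9 hV) (wedge_op_parity _ hV).
  rewrite (adjointZ (metric_sym p) (metric_det p) odd9) conjci.
  by rewrite scalerA mulrN -expr2 sqr_i opprK scale1r.
Qed.

End WSD.

Local Close Scope complex_scope.

Theorem theorem2p13 (R : realType) (X : wsd_manifold R) :
  [/\ (forall Phi : X -> 'End(extalg R[i] 9), L3 Phi ->
         forall p : X, preserves_pairing (metric p) (Phi p)),
      (forall Phi : X -> 'End(extalg R[i] 9), L3 Phi ->
         forall p : X, preserves_pairing (metric p) (Phi p)) <->
      (forall Phi : X -> 'End(extalg R[i] 9), L3 Phi ->
         forall p : X,
           adjoint (metric p) (Phi p) =
           - (hodge (metric p) \o (Phi p \o hodge (metric p)))%VF)
    & forall (p : X) (phi : 'End(extalg R[i] 9)),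
        preserves_pairing (metric p) phi <->
        adjoint (metric p) phi =
        - (hodge (metric p) \o (phi \o hodge (metric p)))%VF].
Proof.
have odd9 : odd 9 by [].
have preservesE (p : X) (phi : 'End(extalg R[i] 9)) :=
  preserves_pairingP (metric_sym p) (metric_det p) odd9 phi.
have star_criterion (p : X) (phi : 'End(extalg R[i] 9)) :
    preserves_pairing (metric p) phi <->
    adjoint (metric p) phi =
    - (hodge (metric p) \o (phi \o hodge (metric p)))%VF.
  exact: iff_trans (preservesE p phi)
    (preserves_adjoint (metric_sym p) (metric_det p) odd9 phi).
split=> [Phi L3Phi p| |//].
  by apply/preservesE; apply: L3_preserves.
by split=> h Phi L3Phi p; apply/star_criterion; apply: h.
Qed.
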